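(* Let $\mu_{0s},\hat\mu_{1s},\mu_{1s}$ be probability measures on $\mathbb{R}^d$ such that $\mu_{1s}\ll\mu_{0s}$, with $\phi=d\mu_{1s}/d\mu_{0s}$ nowhere constant, and let $\chi_s(\mathbf{z})=\mu_{0s}(\{\mathbf{x}:\phi(\mathbf{x})>\phi(\mathbf{z})\})$ for $\mathbf{z}\in\mathbb{R}^d$. Let $\mathbf{X}_s\sim\mu_{1s}$, $Y_s=\chi_s(\mathbf{X}_s)$ with cumulative distribution function $F_s$, and let $\hat{\mathbf{X}}_s\sim\hat\mu_{1s}$, $\hat Y_s=\chi_s(\hat{\mathbf{X}}_s)$ with cumulative distribution function $\hat F_s$. Let $\epsilon\ge0$. If $|\mu_{1s}(A)-\hat\mu_{1s}(A)|\le\epsilon\,\mu_{1s}(A)$ for every measurable set $A$, then $$|\hat F_s(y_s)-F_s(y_s)|\le\epsilon\,F_s(y_s)\qquad\text{for all } y_s\in[0,1].$$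
   Context: ''$\phi$ is nowhere constant'' means $\mu_{0s}\{\mathbf{x}:\phi(\mathbf{x})=c\}=0$ for every $c$. *)

(* Defs.v *)
From HB Require Import structures.
From mathcomp Require Import all_boot all_order all_algebra.
From mathcomp Require Import all_classical all_reals all_analysis.
From mathcomp Require Import measurable_realfun.
Set Implicit Arguments.
Unset Strict Implicit.
Unset Printing Implicit Defensive.
Import Order.TTheory GRing.Theory Num.Theory.
Import numFieldNormedType.Exports.
Local Open Scope classical_set_scope.
Local Open Scope ring_scope.

(* [phi] ranges over all real-valued versions of the Radon-Nikodym derivative,
   not only the one picked by the library. *)
Definition is_RN_derivative d (T : measurableType d) (R : realType)
    (nu mu : probability T R) (phi : {mfun T >-> R}) : Prop :=
  ae_eq mu setT (EFin \o phi)
    (Radon_Nikodym (charge_of_finite_measure nu) mu).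

Definition nowhere_constant d (T : measurableType d) (R : realType)
    (mu : probability T R) (phi : T -> R) : Prop :=
  forall c : R, mu [set x | phi x = c] = 0%E.

Definition chi d (T : measurableType d) (R : realType)
    (mu : probability T R) (phi : {mfun T >-> R}) (z : T) : R :=
  fine (mu [set x | phi x > phi z]).

(* Makes [chi mu phi \o X] a random variable whenever [X] is one. *)
Lemma measurable_chi d (T : measurableType d) (R : realType)
    (mu : probability T R) (phi : {mfun T >-> R}) :
  measurable_fun [set: T] (chi mu phi).
Proof.
pose h := fun t : R => fine (mu [set x | phi x > t]).
have mgt t : measurable [set x | phi x > t].
  rewrite (_ : [set x | _] = phi @^-1` `]t, +oo[%classic).
    exact: measurable_funPTI.
  by apply/seteqP; split=> x /=; rewrite in_itv /= andbT.
have mh : measurable_fun [set: R] h.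
  apply: nonincreasing_measurable => // s t st.
  rewrite fine_le ?fin_num_measure // le_measure ?inE // => x /=.
  exact: le_lt_trans.
exact: (measurableT_comp mh).
Qed.

HB.instance Definition _ d (T : measurableType d) (R : realType)
    (mu : probability T R) (phi : {mfun T >-> R}) :=
  isMeasurableFun.Build _ _ _ _ (chi mu phi) (measurable_chi mu phi).

Definition has_law d d' (Omega : measurableType d) (T : measurableType d')
    (R : realType) (P : probability Omega R) (X : {RV P >-> T})
    (mu : probability T R) : Prop :=
  forall A, measurable A -> distribution P X A = mu A.

(* Main.v *)
Require Import Defs.
From mathcomp Require Import all_boot all_order all_algebra.
From mathcomp Require Import all_classical all_reals all_analysis.
Import Order.TTheory GRing.Theory Num.Theory.
Local Open Scope classical_set_scope.
Local Open Scope ring_scope.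
Local Open Scope ereal_scope.

(* R^n is [n.-tuple R] with the product of the Borel sigma-algebras of R. *)
Theorem theorem6p2 (R : realType) (n : nat)
    (mu0 muhat1 mu1 : probability (n.-tuple R) R)
    (phi : {mfun n.-tuple R >-> R})
    (mu1_ac : mu1 `<< mu0)
    (phi_RN : is_RN_derivative mu1 mu0 phi)
    (phi_nc : nowhere_constant mu0 phi)
    (d : measure_display) (Omega : measurableType d) (P : probability Omega R)
    (X : {RV P >-> n.-tuple R}) (X_law : has_law X mu1)
    (dhat : measure_display) (Omegahat : measurableType dhat)
    (Phat : probability Omegahat R)
    (Xhat : {RV Phat >-> n.-tuple R}) (Xhat_law : has_law Xhat muhat1)
    (eps : R) (eps_ge0 : (0 <= eps)%R)
    (mu1_close : forall A : set (n.-tuple R), measurable A ->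
       `|mu1 A - muhat1 A| <= eps%:E * mu1 A) :
  let Y : {RV P >-> R} := chi mu0 phi \o X in
  let Yhat : {RV Phat >-> R} := chi mu0 phi \o Xhat in
  forall y : R, (0 <= y <= 1)%R ->
    `|cdf Yhat y - cdf Y y| <= eps%:E * cdf Y y.
Proof.
move=> Y Yhat y _.
(* Both distribution functions at [y] measure the same sublevel set [A] of [chi mu0 phi], one with
   [mu1] and the other with [muhat1]. The bound is therefore [mu1_close] at this [A]. *)
pose A := chi mu0 phi @^-1` `]-oo, y]%classic.
have mA : measurable A by exact: measurable_funPTI.
(* The preimage of the half-line under [Y] is, by conversion, the preimage of [A] under [X], so the
   law of [X] suffices. *)
have -> : cdf Y y = mu1 A by rewrite -(X_law _ mA).
have -> : cdf Yhat y = muhat1 A by rewrite -(Xhat_law _ mA).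
(* [mu1_close] has the difference in the opposite order; the sign distributes over it in the
   extended reals because both measures are finite. *)
by rewrite -abseN fin_num_oppeB ?fin_num_measure // addeC mu1_close.
Qed.
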